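(* Let $\mathbf a=(a_i)_{i\in\mathbb Z^s}$ be a mask (as defined in the context). The barycentric refinement scheme associated to $\mathbf a$ is convergent on every Hadamard space $(X,d)$ if and only if it is convergent for $X=\mathbb R$ (with the metric $|\cdot-\cdot|$), i.e. if and only if the linear scheme $\widetilde S x_i=\sum_{j\in\mathbb Z^s}a_{i-2j}x_j$ on $\ell^\infty(\mathbb Z^s,\mathbb R)$ is convergent.
   Context: A Hadamard space is a complete metric space $(X,d)$ such that for any $x_0,x_1\in X$ there is $y\in X$ with $d(z,y)^2\le \frac12 d(z,x_0)^2+\frac12 d(z,x_1)^2-\frac14 d(x_0,x_1)^2$ for all $z\in X$. A mask is a sequence $\mathbf a=(a_i)_{i\in\mathbb Z^s}$ of nonnegative reals with finite support satisfying the basic sum rule $\sum_{j\in\mathbb Z^s}a_{i-2j}=1$ for all $i\in\mathbb Z^s$. The barycentric refinement scheme associated to $\mathbf a$ on a Hadamard space $X$ is the map $S:\ell^\infty(\mathbb Z^s,X)\to\ell^\infty(\mathbb Z^s,X)$, $Sx_i=\operatorname{argmin}_{y\in X}\sum_{j\in\mathbb Z^s}a_{i-2j}d^2(x_j,y)$ (the minimizer exists and is unique); for $X=\mathbb R$ it equals $\widetilde S x_i=\sum_j a_{i-2j}x_j$. A map $S:\ell^\infty(\mathbb Z^s,X)\to\ell^\infty(\mathbb Z^s,X)$ is called convergent if for every $x\in\ell^\infty(\mathbb Z^s,X)$ there is a continuous $S^\infty x:\mathbb R^s\to X$ with $\sup_{j\in\mathbb Z^s}d\big(S^\infty x(j/2^n),(S^nx)_j\big)\to0$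 as $n\to\infty$. *)

(* Defs.v *)
From Stdlib Require Import Reals Lra ZArith List Classical ClassicalEpsilon.
From Stdlib Require Vectors.Fin.
Open Scope R_scope.

Definition idx (s : nat) : Type := Fin.t s -> Z.

Definition idx_sub2 {s : nat} (i j : idx s) : idx s := fun k => (i k - 2 * j k)%Z.

Fixpoint sum_list {A : Type} (f : A -> R) (L : list A) : R :=
  match L with nil => 0 | x :: L' => f x + sum_list f L' end.

Definition fsum_eq {A : Type} (f : A -> R) (v : R) : Prop :=
  exists L : list A, NoDup L /\ (forall j, f j <> 0 -> In j L) /\ sum_list f L = v.

(* The (well-defined for finitely supported f) value of sum_j f j. *)
Definition fsum {A : Type} (f : A -> R) : R :=
  epsilon (inhabits 0) (fun v => fsum_eq f v).

Definition is_mask {s : nat} (a : idx s -> R) : Prop :=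
  (forall i, 0 <= a i) /\
  (exists L : list (idx s), forall i, a i <> 0 -> In i L) /\
  (forall i : idx s, fsum_eq (fun j => a (idx_sub2 i j)) 1).

Definition is_metric {X : Type} (d : X -> X -> R) : Prop :=
  (forall x y, 0 <= d x y) /\
  (forall x y, d x y = 0 <-> x = y) /\
  (forall x y, d x y = d y x) /\
  (forall x y z, d x z <= d x y + d y z).

Definition is_complete {X : Type} (d : X -> X -> R) : Prop :=
  forall u : nat -> X,
    (forall eps, eps > 0 -> exists N, forall m n, (m >= N)%nat -> (n >= N)%nat ->
        d (u m) (u n) < eps) ->
    exists l : X, forall eps, eps > 0 -> exists N, forall n, (n >= N)%nat -> d (u n) l < eps.

Definition is_hadamard {X : Type} (d : X -> X -> R) : Prop :=
  is_metric d /\ is_complete d /\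
  forall x0 x1 : X, exists y : X, forall z : X,
    (d z y)^2 <= /2 * (d z x0)^2 + /2 * (d z x1)^2 - /4 * (d x0 x1)^2.

Definition Rabs_dist (x y : R) : R := Rabs (x - y).

Definition bounded {X : Type} (d : X -> X -> R) {s : nat} (x : idx s -> X) : Prop :=
  exists (z : X) (M : R), forall j, d z (x j) <= M.

Definition bary_obj {X : Type} (d : X -> X -> R) {s : nat} (a : idx s -> R)
  (x : idx s -> X) (i : idx s) (y : X) : R :=
  fsum (fun j => a (idx_sub2 i j) * (d (x j) y)^2).

Definition is_argmin {X : Type} (F : X -> R) (y : X) : Prop :=
  forall z, F y <= F z.

Definition bary_scheme {X : Type} (d : X -> X -> R) {s : nat} (a : idx s -> R)
  (x : idx s -> X) : idx s -> X :=
  fun i => epsilon (inhabits (x i)) (is_argmin (bary_obj d a x i)).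

Definition lin_scheme {s : nat} (a : idx s -> R) (x : idx s -> R) : idx s -> R :=
  fun i => fsum (fun j => a (idx_sub2 i j) * x j).

Definition continuous_Rs {X : Type} (d : X -> X -> R) {s : nat}
  (f : (Fin.t s -> R) -> X) : Prop :=
  forall (p : Fin.t s -> R) (eps : R), eps > 0 -> exists delta, delta > 0 /\
    forall q : Fin.t s -> R, (forall k, Rabs (q k - p k) < delta) -> d (f p) (f q) < eps.

Definition dyadic {s : nat} (n : nat) (j : idx s) : Fin.t s -> R :=
  fun k => IZR (j k) / 2 ^ n.

Definition convergent {X : Type} (d : X -> X -> R) {s : nat}
  (S : (idx s -> X) -> (idx s -> X)) : Prop :=
  forall x : idx s -> X, bounded d x ->
    exists f : (Fin.t s -> R) -> X, continuous_Rs d f /\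
      forall eps, eps > 0 -> exists N, forall n, (n >= N)%nat ->
        forall j, d (f (dyadic n j)) (Nat.iter n S x j) <= eps.

(* Main.v *)
(* The mask is the transition kernel of a Markov chain [i -> j] with probability [a (i - 2 j)],
   whose operator [P] is the linear scheme; the barycentric scheme [S] takes conditional
   barycenters along this chain.  If the linear scheme converges, uniform continuity of the limit of
   the delta sequence gives an [m] such that any two neighbouring indices reach, in [m] steps, a
   common index with probability bounded below.  Hence if the [m]-step variances at two neighbours
   are small, so is the distance of the values of [S^m x] there.  The variance inequality
   [d^2(z, S x_i) + P(d^2(x, S x_i))_i <= P(d^2(x, z))_i] bounds the total variance collected along
   the chain independently of the number of steps, so after sufficiently many blocks of [m] steps
   neighbouring values are closer by a factor [2].  Jensen's inequality for [d^2] then turns this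
   contraction into uniform convergence.  The converse holds because the barycentric scheme on [R]
   is the linear one. *)
Require Import Defs.
From Stdlib Require Import Reals Lra Lia ZArith List Permutation Classical ClassicalEpsilon
  FunctionalExtensionality.
From Stdlib Require Vectors.Fin.
Open Scope R_scope.

(** * Finite sums *)

Lemma sum_list_ext {A : Type} (f g : A -> R) (L : list A) :
  (forall x, f x = g x) -> sum_list f L = sum_list g L.
Proof. intros H; induction L as [|x L IH]; simpl; [easy|]. rewrite H, IH; easy. Qed.

Lemma sum_list_le {A : Type} (f g : A -> R) (L : list A) :
  (forall x, f x <= g x) -> sum_list f L <= sum_list g L.
Proof. intros H; induction L as [|x L IH]; simpl; [lra|]. specialize (H x); lra. Qed.

Lemma sum_list_comb {A : Type} (al be : R) (f g : A -> R) (L : list A) :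
  sum_list (fun x => al * f x + be * g x) L = al * sum_list f L + be * sum_list g L.
Proof. induction L as [|x L IH]; simpl; [ring|]. rewrite IH; ring. Qed.

Lemma sum_list_const {A : Type} (c : R) (L : list A) :
  sum_list (fun _ => c) L = INR (length L) * c.
Proof. induction L as [|x L IH]; [simpl; ring|]. cbn [sum_list length]. rewrite IH, S_INR; ring. Qed.

Lemma sum_list_map {A B : Type} (h : A -> B) (f : B -> R) (L : list A) :
  sum_list f (map h L) = sum_list (fun x => f (h x)) L.
Proof. induction L as [|x L IH]; simpl; [easy|]. now rewrite IH. Qed.

Lemma sum_list_perm {A : Type} (f : A -> R) (L L' : list A) :
  Permutation L L' -> sum_list f L = sum_list f L'.
Proof. induction 1; simpl; lra. Qed.

Lemma sum_list_filter_nonzero {A : Type} (f : A -> R) (L : list A) :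
  sum_list f (filter (fun x => if Req_dec_T (f x) 0 then false else true) L) = sum_list f L.
Proof.
  induction L as [|x L IH]; simpl; [easy|].
  destruct (Req_dec_T (f x) 0); simpl; lra.
Qed.

(** Once zero terms are discarded, both lists enumerate the support without repetition and are
    permutations of each other. This makes the value picked by [fsum] independent of the list. *)
Lemma sum_list_support_unique {A : Type} (f : A -> R) (L L' : list A) :
  NoDup L -> NoDup L' ->
  (forall j, f j <> 0 -> In j L) -> (forall j, f j <> 0 -> In j L') ->
  sum_list f L = sum_list f L'.
Proof.
  intros N N' H H'.
  rewrite <- (sum_list_filter_nonzero f L), <- (sum_list_filter_nonzero f L').
  apply sum_list_perm, NoDup_Permutation; try now apply NoDup_filter.
  intros x; rewrite !filter_In.
  destruct (Req_dec_T (f x) 0) as [E|E]; firstorder congruence.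
Qed.

Lemma fsum_list {A : Type} (f : A -> R) (L : list A) :
  NoDup L -> (forall j, f j <> 0 -> In j L) -> fsum f = sum_list f L.
Proof.
  intros N H. unfold fsum.
  destruct (epsilon_spec (inhabits 0) (fun v => fsum_eq f v)) as (L' & N' & H' & E).
  - exists (sum_list f L), L; auto.
  - rewrite <- E; now apply sum_list_support_unique.
Qed.

(** * The Markov operator of a mask *)

Lemma lin_scheme_list {s : nat} (a : idx s -> R) (f : idx s -> R) (i : idx s) (L : list (idx s)) :
  NoDup L -> (forall j, a (idx_sub2 i j) <> 0 -> In j L) ->
  lin_scheme a f i = sum_list (fun j => a (idx_sub2 i j) * f j) L.
Proof.
  intros N H; apply fsum_list; auto. intros j Hj; apply H; intros E; apply Hj; rewrite E; ring.
Qed.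

Lemma lin_scheme_comb {s : nat} (a : idx s -> R) (ha : is_mask a) (al be : R)
  (f g : idx s -> R) (i : idx s) :
  lin_scheme a (fun j => al * f j + be * g j) i = al * lin_scheme a f i + be * lin_scheme a g i.
Proof.
  destruct ha as (_ & _ & h). destruct (h i) as (L & N & H & _).
  rewrite !(lin_scheme_list a _ i L N H), <- sum_list_comb.
  apply sum_list_ext; intros; ring.
Qed.

Lemma lin_scheme_const {s : nat} (a : idx s -> R) (ha : is_mask a) (c : R) (i : idx s) :
  lin_scheme a (fun _ => c) i = c.
Proof.
  destruct ha as (_ & _ & h). destruct (h i) as (L & N & H & E).
  rewrite (lin_scheme_list a _ i L N H).
  rewrite (sum_list_ext _ (fun j => c * a (idx_sub2 i j) + 0 * a (idx_sub2 i j)));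
    [|intros; ring].
  rewrite sum_list_comb, E; ring.
Qed.

Lemma lin_scheme_le {s : nat} (a : idx s -> R) (ha : is_mask a) (f g : idx s -> R) (i : idx s) :
  (forall j, a (idx_sub2 i j) <> 0 -> f j <= g j) -> lin_scheme a f i <= lin_scheme a g i.
Proof.
  intros Hfg. destruct ha as (p & _ & h). destruct (h i) as (L & N & H & _).
  rewrite !(lin_scheme_list a _ i L N H). apply sum_list_le; intros j.
  destruct (Req_dec_T (a (idx_sub2 i j)) 0) as [E|E].
  - rewrite E; lra.
  - apply Rmult_le_compat_l; auto.
Qed.

(** Translating level-[0] indices by [q] amounts to translating level-[n] indices by [2 ^ n * q];
    the factor [c] records this power, and [c = -1] inverts [c = 1]. *)
Definition shift {s : nat} (c : Z) (q i : idx s) : idx s := fun k => (i k - c * q k)%Z.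

Lemma lin_scheme_shift {s : nat} (a : idx s -> R) (ha : is_mask a) (f : idx s -> R) (q i : idx s) :
  lin_scheme a f (shift 2 q i) = lin_scheme a (fun j => f (shift 1 q j)) i.
Proof.
  destruct ha as (_ & _ & h). destruct (h (shift 2 q i)) as (L & N & H & _).
  rewrite (lin_scheme_list a f _ L N H).
  assert (E : forall j, idx_sub2 i (shift (-1) q j) = idx_sub2 (shift 2 q i) j).
  { intros j; extensionality k; unfold idx_sub2, shift; lia. }
  assert (S1 : forall j, shift 1 q (shift (-1) q j) = j).
  { intros j; extensionality k; unfold shift; lia. }
  assert (S2 : forall j, shift (-1) q (shift 1 q j) = j).
  { intros j; extensionality k; unfold shift; lia. }
  rewrite (lin_scheme_list a _ i (map (shift (-1) q) L)).
  - rewrite sum_list_map; apply sum_list_ext; intros j; now rewrite E, S1.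
  - apply NoDup_map_NoDup_ForallPairs; auto.
    intros x y _ _ Exy; now rewrite <- (S1 x), Exy, S1.
  - intros j Hj. rewrite <- (S2 j); apply in_map, H. now rewrite <- E, S2.
Qed.

(** * Range of influence of the mask across levels *)

Definition mask_radius {s : nat} (a : idx s -> R) (A : Z) : Prop :=
  (1 <= A)%Z /\ forall i, a i <> 0 -> forall k, (Z.abs (i k) <= A)%Z.

Lemma idx_bounded {s : nat} (i : idx s) : exists M, forall k, (Z.abs (i k) <= M)%Z.
Proof.
  induction s as [|s IH].
  - exists 0%Z; intros k; apply (Fin.case0 (fun k => (Z.abs (i k) <= 0)%Z)).
  - destruct (IH (fun k => i (Fin.FS k))) as [M HM].
    exists (Z.max M (Z.abs (i Fin.F1))). intros k.
    apply (Fin.caseS' k (fun k => (Z.abs (i k) <= _)%Z)); [lia|].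
    intros k'; specialize (HM k'); simpl in HM; lia.
Qed.

Lemma mask_radius_exists {s : nat} (a : idx s -> R) (ha : is_mask a) :
  exists A, mask_radius a A.
Proof.
  destruct ha as (_ & (L & HL) & _).
  assert (HA : exists A, (1 <= A)%Z /\ forall i, In i L -> forall k, (Z.abs (i k) <= A)%Z).
  { clear HL; induction L as [|j L (A & HA1 & HA)].
    - exists 1%Z; split; [lia|intros i []].
    - destruct (idx_bounded j) as [M HM]. exists (Z.max A M). split; [lia|].
      intros i [<-|Hi] k; [specialize (HM k)|specialize (HA i Hi k)]; lia. }
  destruct HA as (A & HA1 & HA). exists A; split; auto.
Qed.

(* The index [j] at level [0] may influence the index [i] at level [n]. *)
Definition reach {s : nat} (A : Z) (n : nat) (i j : idx s) : Prop :=
  forall k, (Z.abs (i k - 2 ^ Z.of_nat n * j k) <= (2 ^ Z.of_nat n - 1) * A)%Z.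

(* The threshold [2 * A] makes the relation stable under [reach], see [reach_near]. *)
Definition near {s : nat} (A : Z) (i i' : idx s) : Prop :=
  forall k, (Z.abs (i k - i' k) <= 2 * A)%Z.

Lemma near_refl {s : nat} (A : Z) (i : idx s) : (1 <= A)%Z -> near A i i.
Proof. intros HA k; lia. Qed.

Lemma near_sym {s : nat} (A : Z) (i i' : idx s) : near A i i' -> near A i' i.
Proof. intros H k; specialize (H k); lia. Qed.

Lemma Zpow2_S (n : nat) : (2 ^ Z.of_nat (S n) = 2 * 2 ^ Z.of_nat n)%Z.
Proof. rewrite Nat2Z.inj_succ, Z.pow_succ_r; lia. Qed.

Lemma Zpow2_pos (n : nat) : (1 <= 2 ^ Z.of_nat n)%Z.
Proof. assert (0 < 2 ^ Z.of_nat n)%Z by (apply Z.pow_pos_nonneg; lia); lia. Qed.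

Lemma IZR_pow2 (n : nat) : IZR (2 ^ Z.of_nat n) = 2 ^ n.
Proof. now rewrite <- pow_IZR. Qed.

(** With [p = 2 ^ n], the triangle inequality gives [p * |j - j'| <= 2 * A + 2 * (p - 1) * A = 2 * p
    * A], so the threshold reproduces itself. *)
Lemma reach_near {s : nat} (A : Z) (n : nat) (i i' j j' : idx s) :
  near A i i' -> reach A n i j -> reach A n i' j' -> near A j j'.
Proof.
  intros H Hj Hj' k. specialize (H k); specialize (Hj k); specialize (Hj' k).
  pose proof (Zpow2_pos n) as Hp. set (p := (2 ^ Z.of_nat n)%Z) in *. nia.
Qed.

(** Split [i - 2 * p * q] as [(i - 2 * j) + 2 * (j - p * q)]; the bounds add up to
    [A + 2 * (p - 1) * A = (2 * p - 1) * A]. *)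
Lemma reach_trans {s : nat} (a : idx s -> R) (A : Z) (n : nat) (i j q : idx s) :
  mask_radius a A -> a (idx_sub2 i j) <> 0 -> reach A n j q -> reach A (S n) i q.
Proof.
  intros (HA & H) Hij Hq k. specialize (H _ Hij k); specialize (Hq k). unfold idx_sub2 in H.
  rewrite Zpow2_S. pose proof (Zpow2_pos n) as Hp. set (p := (2 ^ Z.of_nat n)%Z) in *. nia.
Qed.

Lemma iter_lin_le {s : nat} (a : idx s -> R) (ha : is_mask a) (A : Z) (hA : mask_radius a A)
  (n : nat) (f g : idx s -> R) (i : idx s) :
  (forall j, reach A n i j -> f j <= g j) ->
  Nat.iter n (lin_scheme a) f i <= Nat.iter n (lin_scheme a) g i.
Proof.
  revert i; induction n as [|n IH]; intros i H; simpl.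
  - apply H; intros k; simpl (2 ^ _)%Z; lia.
  - apply lin_scheme_le; auto. intros j Hj; apply IH.
    intros q Hq; apply H. eapply reach_trans; eauto.
Qed.

Lemma iter_lin_comb {s : nat} (a : idx s -> R) (ha : is_mask a) (n : nat) (al be c : R)
  (f g : idx s -> R) (i : idx s) :
  Nat.iter n (lin_scheme a) (fun j => al * f j + be * g j + c) i =
  al * Nat.iter n (lin_scheme a) f i + be * Nat.iter n (lin_scheme a) g i + c.
Proof.
  revert i; induction n as [|n IH]; intros i; simpl; [easy|].
  rewrite (functional_extensionality _ _ IH).
  transitivity (lin_scheme a (fun j => 1 * (al * Nat.iter n (lin_scheme a) f j
    + be * Nat.iter n (lin_scheme a) g j) + 1 * c) i).
  - f_equal; extensionality j; ring.
  - rewrite !lin_scheme_comb, lin_scheme_const by easy; ring.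
Qed.

(** Weights are nonnegative, sum to one and vanish off the reachable indices, so a local pointwise
    inequality may be averaged and its constant survives unchanged. Most later estimates are cast in
    this form. *)
Lemma iter_lin_le_comb {s : nat} (a : idx s -> R) (ha : is_mask a) (A : Z) (hA : mask_radius a A)
  (n : nat) (al be c : R) (f g h : idx s -> R) (i : idx s) :
  (forall j, reach A n i j -> f j <= al * g j + be * h j + c) ->
  Nat.iter n (lin_scheme a) f i <=
  al * Nat.iter n (lin_scheme a) g i + be * Nat.iter n (lin_scheme a) h i + c.
Proof. intros H. rewrite <- iter_lin_comb by easy. eapply iter_lin_le; eauto. Qed.

Lemma iter_lin_shift {s : nat} (a : idx s -> R) (ha : is_mask a) (n : nat) (f : idx s -> R)
  (q i : idx s) :
  Nat.iter n (lin_scheme a) f (shift (2 ^ Z.of_nat n) q i) =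
  Nat.iter n (lin_scheme a) (fun j => f (shift 1 q j)) i.
Proof.
  revert i; induction n as [|n IH]; intros i; [easy|].
  set (q' := fun k => (2 ^ Z.of_nat n * q k)%Z : Z).
  replace (shift (2 ^ Z.of_nat (S n)) q i) with (shift 2 q' i)
    by (extensionality k; unfold shift, q'; rewrite Zpow2_S; lia).
  rewrite !Nat.iter_succ, lin_scheme_shift by easy.
  f_equal; extensionality j. rewrite <- IH. f_equal.
  extensionality k; unfold shift, q'; lia.
Qed.

(** Two independent chains started at near indices stay at near indices, and averaging [h j + h j']
    over the product leaves the two marginals. *)
Lemma iter_lin_couple {s : nat} (a : idx s -> R) (ha : is_mask a) (A : Z) (hA : mask_radius a A)
  (n : nat) (g : idx s -> idx s -> R) (h : idx s -> R) (i i' : idx s) :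
  near A i i' ->
  (forall j j', near A j j' -> g j j' <= h j + h j') ->
  Nat.iter n (lin_scheme a) (fun j => Nat.iter n (lin_scheme a) (g j) i') i <=
  Nat.iter n (lin_scheme a) h i + Nat.iter n (lin_scheme a) h i'.
Proof.
  intros Hi H. set (c := Nat.iter n (lin_scheme a) h i').
  replace (Nat.iter n (lin_scheme a) h i + c)
    with (1 * Nat.iter n (lin_scheme a) h i + 0 * Nat.iter n (lin_scheme a) h i + c) by ring.
  eapply iter_lin_le_comb; eauto. intros j Hj.
  replace (1 * h j + 0 * h j + c) with (1 * c + 0 * c + h j) by ring.
  eapply iter_lin_le_comb; eauto. intros j' Hj'.
  assert (near A j j') by (eapply reach_near; eauto). specialize (H j j' H0); lra.
Qed.

Lemma lin_scheme_le_comb {s : nat} (a : idx s -> R) (ha : is_mask a) (al be c : R)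
  (f g h : idx s -> R) (i : idx s) :
  (forall j, f j <= al * g j + be * h j + c) ->
  lin_scheme a f i <= al * lin_scheme a g i + be * lin_scheme a h i + c.
Proof.
  intros H. destruct (mask_radius_exists a ha) as (A & hA).
  apply (iter_lin_le_comb a ha A hA 1). auto.
Qed.

Lemma lin_scheme_nonneg {s : nat} (a : idx s -> R) (ha : is_mask a) (f : idx s -> R) (i : idx s) :
  (forall j, 0 <= f j) -> 0 <= lin_scheme a f i.
Proof. intros H. rewrite <- (lin_scheme_const a ha 0 i). now apply lin_scheme_le. Qed.

(** * Barycenters in Hadamard spaces *)

Lemma scaled_pow_half_small (C eps : R) :
  0 < eps -> exists N, forall n, (n >= N)%nat -> C * (1 / 2) ^ n < eps.
Proof.
  intros He. pose proof (Rabs_pos C) as HC. pose proof (Rle_abs C) as HC'.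
  destruct (pow_lt_1_zero (1 / 2)) with (y := eps / (Rabs C + 1)) as (N & HN).
  - rewrite Rabs_pos_eq; lra.
  - apply Rdiv_lt_0_compat; lra.
  - exists N; intros n Hn. specialize (HN n Hn).
    assert (Hp : 0 < (1 / 2) ^ n) by (apply pow_lt; lra).
    rewrite Rabs_pos_eq in HN by lra.
    apply Rmult_lt_compat_r with (r := Rabs C + 1) in HN; [|lra].
    replace (eps / (Rabs C + 1) * (Rabs C + 1)) with eps in HN by (field; lra). nra.
Qed.

Lemma le_of_le_pow_half (u v C : R) :
  (forall n, u <= v + C * (1 / 2) ^ n) -> u <= v.
Proof.
  intros H. apply le_epsilon; intros eps He.
  destruct (scaled_pow_half_small C eps He) as (N & HN).
  specialize (HN N (le_n N)); specialize (H N); lra.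
Qed.

(** After the triangle inequality this is Young's inequality, whose slack is the square
    [(eta * u - v)^2 / eta]. *)
Lemma dist_sq_le {X : Type} (d : X -> X -> R) (hd : is_metric d) (x y z : X) (eta : R) :
  0 < eta -> (d x z)^2 <= (1 + eta) * (d x y)^2 + (1 + / eta) * (d y z)^2.
Proof.
  intros He. destruct hd as (p & _ & _ & t). pose proof (t x y z); pose proof (p x z).
  pose proof (p x y) as P1; pose proof (p y z) as P2.
  set (u := d x y) in *; set (v := d y z) in *.
  assert ((d x z)^2 <= (u + v)^2) by (apply pow_incr; lra).
  assert (E : (1 + eta) * u^2 + (1 + / eta) * v^2 - (u + v)^2 = / eta * (eta * u - v)^2)
    by (field; lra).
  assert (0 <= / eta * (eta * u - v)^2).
  { apply Rmult_le_pos; [left; now apply Rinv_0_lt_compat | apply pow2_ge_0]. }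
  lra.
Qed.

Lemma dist_sq_le2 {X : Type} (d : X -> X -> R) (hd : is_metric d) (x y z : X) :
  (d x z)^2 <= 2 * (d x y)^2 + 2 * (d y z)^2.
Proof. pose proof (dist_sq_le d hd x y z 1 Rlt_0_1). rewrite Rinv_1 in H; lra. Qed.

(** The Hadamard inequality for the midpoint [m] is averaged with the mask weights, which makes the
    objective uniformly convex. At [z = y'] the same inequality gives [d y' m <= d y y' / 2], whence
    the lower bound on [d m y]. *)
Lemma bary_obj_midpoint {X : Type} (d : X -> X -> R) (hX : is_hadamard d) {s : nat}
  (a : idx s -> R) (ha : is_mask a) (x : idx s -> X) (i : idx s) (y y' : X) :
  exists m, bary_obj d a x i m <=
    / 2 * bary_obj d a x i y + / 2 * bary_obj d a x i y' - / 4 * (d y y')^2 /\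
    / 2 * d y y' <= d m y.
Proof.
  destruct hX as ((p & e & c & t) & _ & h). destruct (h y y') as (m & Hm). exists m; split.
  - apply lin_scheme_le_comb; [easy|]. intros j. exact (Hm (x j)).
  - specialize (Hm y'). rewrite (c y' y) in Hm.
    assert (E : d y' y' = 0) by now apply e.
    rewrite E in Hm. specialize (t y m y'). rewrite (c y m), (c m y') in t.
    pose proof (p y' m); pose proof (p y y'); nra.
Qed.

(** Uniform convexity makes every minimizing sequence Cauchy; completeness provides its limit, and
    [dist_sq_le] with small [eta] shows that the objective does not jump up there. *)
Lemma bary_obj_argmin_exists {X : Type} (d : X -> X -> R) (hX : is_hadamard d) {s : nat}
  (a : idx s -> R) (ha : is_mask a) (x : idx s -> X) (i : idx s) :
  exists b, is_argmin (bary_obj d a x i) b.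
Proof.
  set (F := bary_obj d a x i).
  assert (F0 : forall y, 0 <= F y).
  { intros y; apply lin_scheme_nonneg; auto. intros j; apply pow2_ge_0. }
  (* The infimum of [F] is [- w], taken as the negative of a supremum. *)
  destruct (completeness (fun r => exists y, r = - F y)) as (w & Hub & Hlub).
  { exists 0; intros r (y & ->); specialize (F0 y); lra. }
  { exists (- F (x i)); eauto. }
  assert (Hinf : forall y, - w <= F y) by (intros y; specialize (Hub (- F y)); cut (- F y <= w);
    [lra|eauto]).
  assert (Happ : forall n : nat, exists y, F y < - w + (1 / 2) ^ n).
  { intros n. apply NNPP; intros H.
    assert (Hp : 0 < (1 / 2) ^ n) by (apply pow_lt; lra).
    cut (w <= w - (1 / 2) ^ n); [lra|]. apply Hlub; intros r (y & ->).
    destruct (Rle_lt_dec (- w + (1 / 2) ^ n) (F y)); [lra|exfalso; eauto]. }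
  assert (w0 : 0 <= - w).
  { cut (w <= 0); [lra|]. apply Hlub; intros r (y & ->); specialize (F0 y); lra. }
  clear Hub Hlub. set (v := - w) in *.
  set (y := fun n => proj1_sig (constructive_indefinite_description _ (Happ n))).
  assert (Hy : forall n, F (y n) < v + (1 / 2) ^ n)
    by (intros n; exact (proj2_sig (constructive_indefinite_description _ (Happ n)))).
  assert (hm : is_metric d) by apply hX.
  assert (hc : is_complete d) by apply hX. pose proof hm as (p & _).
  destruct (hc y) as (l & Hl).
  (* The midpoint [q] satisfies [F q >= v], so [(d (y m) (y n))^2 / 4] is less than the mean of the
     two excesses, each below [eps ^ 2 / 4]. *)
  { intros eps He. destruct (scaled_pow_half_small 4 (eps ^ 2)) as (N & HN); [apply pow_lt; lra|].
    exists N; intros m n Hm' Hn'.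
    destruct (bary_obj_midpoint d hX a ha x i (y m) (y n)) as (q & Hq & _). fold F in Hq.
    specialize (HN _ Hm') as H1; specialize (HN _ Hn') as H2.
    pose proof (Hy m); pose proof (Hy n); pose proof (Hinf q).
    destruct (Rlt_le_dec (d (y m) (y n)) eps) as [|Hge]; auto.
    assert (eps ^ 2 <= (d (y m) (y n)) ^ 2) by (apply pow_incr; lra). lra. }
  exists l. intros z. apply Rle_trans with v; [|auto]. fold F.
  apply le_epsilon; intros eps0 He0.
  (* The error budget is [eps / 4] for the excess of [F (y n)], [eps / 4] for the factor [1 + eta]
     and [eps / 2] for the distance term. The cap at [1] ensures [D <= 1], so that [D^2 <= D]. *)
  set (eps := Rmin eps0 1).
  assert (He : 0 < eps <= 1) by (unfold eps; split; [apply Rmin_glb_lt; lra|apply Rmin_r]).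
  assert (He1 : eps <= eps0) by apply Rmin_l.
  set (eta := eps / (4 * (v + 1))).
  assert (Hee : eta * (v + 1) = eps / 4) by (unfold eta; field; lra).
  assert (Heta : 0 < eta) by (apply Rdiv_lt_0_compat; lra).
  set (K := 1 + / eta).
  assert (HK : 1 < K) by (pose proof (Rinv_0_lt_compat _ Heta); unfold K; lra).
  destruct (scaled_pow_half_small 1 (eps / 4)) as (N1 & HN1); [lra|].
  destruct (Hl (eps / (2 * K))) as (N2 & HN2); [apply Rdiv_lt_0_compat; lra|].
  set (n := (N1 + N2)%nat).
  assert (Hn1 : (n >= N1)%nat) by (unfold n; lia).
  assert (Hn2 : (n >= N2)%nat) by (unfold n; lia).
  specialize (HN1 n Hn1); specialize (HN2 n Hn2); specialize (Hy n).
  assert (HF : F l <= (1 + eta) * F (y n) + 0 * F (y n) + K * (d (y n) l)^2).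
  { apply lin_scheme_le_comb; auto. intros j.
    pose proof (dist_sq_le d hm (x j) (y n) l eta Heta). unfold K; lra. }
  assert (Hd : K * (d (y n) l)^2 <= eps / 2).
  { pose proof (p (y n) l). set (D := d (y n) l) in *.
    assert (HKD : K * D < eps / 2).
    { apply Rmult_lt_compat_l with (r := K) in HN2; [|lra].
      replace (K * (eps / (2 * K))) with (eps / 2) in HN2 by (field; lra). lra. }
    assert (D <= 1) by nra. nra. }
  assert ((1 + eta) * F (y n) <= (1 + eta) * (v + eps / 4)) by (apply Rmult_le_compat_l; lra).
  nra.
Qed.

Lemma bary_obj_argmin_variance {X : Type} (d : X -> X -> R) (hX : is_hadamard d) {s : nat}
  (a : idx s -> R) (ha : is_mask a) (x : idx s -> X) (i : idx s) (b : X) :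
  is_argmin (bary_obj d a x i) b ->
  forall z, (d z b)^2 + bary_obj d a x i b <= bary_obj d a x i z.
Proof.
  intros Hb. set (F := bary_obj d a x i) in *.
  (* If the inequality holds with a factor [k] in front of [(d z b)^2], the midpoint of [z] and
     [b] shows that it holds with [(1 + k) / 2]. *)
  assert (H : forall (n : nat) z, (1 - (1 / 2) ^ n) * (d z b)^2 + F b <= F z).
  { induction n as [|n IH]; intros z.
    - simpl; specialize (Hb z); lra.
    - destruct (bary_obj_midpoint d hX a ha x i b z) as (m & Hm & Hd). fold F in Hm.
      specialize (IH m). destruct hX as ((p & _ & c & _) & _).
      rewrite (c b z) in *. pose proof (p z b).
      assert (/ 4 * (d z b)^2 <= (d m b)^2) by nra.
      assert ((1 - (1 / 2) ^ n) * (/ 4 * (d z b)^2) <= (1 - (1 / 2) ^ n) * (d m b)^2).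
      { apply Rmult_le_compat_l; [|easy].
        assert ((1 / 2) ^ n <= 1 ^ n) by (apply pow_incr; lra). rewrite pow1 in *; lra. }
      simpl ((1 / 2) ^ S n). lra. }
  intros z. apply le_of_le_pow_half with (C := (d z b)^2). intros n; specialize (H n z); lra.
Qed.

Lemma bary_scheme_argmin {X : Type} (d : X -> X -> R) (hX : is_hadamard d) {s : nat}
  (a : idx s -> R) (ha : is_mask a) (x : idx s -> X) (i : idx s) :
  is_argmin (bary_obj d a x i) (bary_scheme d a x i).
Proof.
  apply (epsilon_spec (inhabits (x i)) (is_argmin (bary_obj d a x i))).
  now apply bary_obj_argmin_exists.
Qed.

(** By unfolding, the objective at [z] is the linear scheme applied to the squared distances from
    [z]; this restates the variance inequality in terms of the Markov operator. *)
Lemma bary_scheme_variance {X : Type} (d : X -> X -> R) (hX : is_hadamard d) {s : nat}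
  (a : idx s -> R) (ha : is_mask a) (x : idx s -> X) (i : idx s) (z : X) :
  (d z (bary_scheme d a x i))^2 + lin_scheme a (fun j => (d (x j) (bary_scheme d a x i))^2) i
  <= lin_scheme a (fun j => (d (x j) z)^2) i.
Proof. apply (bary_obj_argmin_variance d hX a ha x i). now apply bary_scheme_argmin. Qed.

(** * The real line as a Hadamard space *)

Lemma Rabs_dist_hadamard : is_hadamard Rabs_dist.
Proof.
  unfold Rabs_dist. split; [|split].
  - repeat split; intros.
    + apply Rabs_pos.
    + destruct (Req_dec_T (x - y) 0); [lra|]. now apply Rabs_no_R0 in n.
    + subst; rewrite Rminus_diag; apply Rabs_R0.
    + apply Rabs_minus_sym.
    + replace (x - z) with ((x - y) + (y - z)) by ring. apply Rabs_triang.
  - intros u Hu. destruct (R_complete u) as (l & Hl).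
    + intros eps He. destruct (Hu eps He) as (N & HN). exists N; intros; now apply HN.
    + exists l. exact Hl.
  - intros x0 x1. exists ((x0 + x1) / 2). intros z. rewrite !pow2_abs. lra.
Qed.

(** Expanding the squares around the weighted mean [m] turns the objective into its value at [m]
    plus [(y - m)^2]. *)
Lemma bary_scheme_Rabs_dist {s : nat} (a : idx s -> R) (ha : is_mask a) :
  bary_scheme Rabs_dist a = lin_scheme a.
Proof.
  extensionality x; extensionality i. set (m := lin_scheme a x i).
  assert (H : forall y, bary_obj Rabs_dist a x i y = bary_obj Rabs_dist a x i m + (y - m)^2).
  { intros y. unfold bary_obj.
    change (lin_scheme a (fun j => (Rabs_dist (x j) y)^2) i =
      lin_scheme a (fun j => (Rabs_dist (x j) m)^2) i + (y - m)^2).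
    assert (E : forall z, lin_scheme a (fun j => (Rabs_dist (x j) z)^2) i =
      lin_scheme a (fun j => (x j)^2) i + (z^2 - 2 * z * m)).
    { intros z. unfold m.
      pose proof (iter_lin_comb a ha 1 1 (- 2 * z) (z^2) (fun j => (x j)^2) x i) as E.
      unfold Nat.iter in E; cbn [nat_rect] in E.
      replace (fun j => (Rabs_dist (x j) z)^2)
        with (fun j => 1 * (x j)^2 + - 2 * z * x j + z^2).
      - rewrite E; ring.
      - extensionality j. unfold Rabs_dist. rewrite pow2_abs. ring. }
    rewrite !E; ring. }
  (* Minimality tested against [m] leaves [(b - m)^2 <= 0]. *)
  pose proof (bary_scheme_argmin Rabs_dist Rabs_dist_hadamard a ha x i m) as Hb.
  rewrite (H (bary_scheme _ a x i)) in Hb.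
  set (b := bary_scheme Rabs_dist a x i) in *. nra.
Qed.

Lemma iter_lin_scal {s : nat} (a : idx s -> R) (ha : is_mask a) (n : nat) (K : R)
  (f : idx s -> R) (i : idx s) :
  Nat.iter n (lin_scheme a) (fun j => K * f j) i = K * Nat.iter n (lin_scheme a) f i.
Proof.
  pose proof (iter_lin_comb a ha n K 0 0 f f i) as E.
  replace (fun j => K * f j) with (fun j => K * f j + 0 * f j + 0)
    by (extensionality j; ring).
  rewrite E; ring.
Qed.

Lemma iter_lin_const {s : nat} (a : idx s -> R) (ha : is_mask a) (n : nat) (c : R) (i : idx s) :
  Nat.iter n (lin_scheme a) (fun _ => c) i = c.
Proof.
  revert i; induction n as [|n IH]; intros i; simpl; [easy|].
  transitivity (lin_scheme a (fun _ => c) i); [|now apply lin_scheme_const].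
  f_equal; extensionality j; apply IH.
Qed.

(** * Variance and contraction *)

(** Each step uses the variance inequality with its nonnegative variance term dropped. *)
Lemma iter_bary_jensen {X : Type} (d : X -> X -> R) (hX : is_hadamard d) {s : nat}
  (a : idx s -> R) (ha : is_mask a) (n : nat) (x : idx s -> X) (i : idx s) (z : X) :
  (d z (Nat.iter n (bary_scheme d a) x i))^2
  <= Nat.iter n (lin_scheme a) (fun j => (d (x j) z)^2) i.
Proof.
  assert (c : forall x y, d x y = d y x) by apply hX.
  revert i; induction n as [|n IH]; intros i.
  - simpl Nat.iter; rewrite (c z); apply Rle_refl.
  - set (y := Nat.iter n (bary_scheme d a) x) in *.
    pose proof (bary_scheme_variance d hX a ha y i z).
    assert (0 <= lin_scheme a (fun j => (d (y j) (bary_scheme d a y i))^2) i)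
      by (apply lin_scheme_nonneg; auto; intros; apply pow2_ge_0).
    apply Rle_trans with (lin_scheme a (fun j => (d (y j) z)^2) i).
    + change (Nat.iter (S n) (bary_scheme d a) x) with (bary_scheme d a y). lra.
    + change (Nat.iter (S n) (lin_scheme a) ?f) with (lin_scheme a (Nat.iter n (lin_scheme a) f)).
      apply lin_scheme_le; auto. intros j _. rewrite c. apply IH.
Qed.

(** Jensen's inequality, applied in one argument of the distance and then in the other, bounds the
    left side by an average over two independent chains. *)
Lemma iter_bary_couple {X : Type} (d : X -> X -> R) (hX : is_hadamard d) {s : nat}
  (a : idx s -> R) (ha : is_mask a) (A : Z) (hA : mask_radius a A) (n : nat) (x : idx s -> X)
  (K : R) (h : idx s -> R) (i i' : idx s) :
  0 <= K -> near A i i' ->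
  (forall j j', near A j j' -> K * (d (x j) (x j'))^2 <= h j + h j') ->
  K * (d (Nat.iter n (bary_scheme d a) x i) (Nat.iter n (bary_scheme d a) x i'))^2 <=
  Nat.iter n (lin_scheme a) h i + Nat.iter n (lin_scheme a) h i'.
Proof.
  intros HK Hi H.
  assert (c : forall x y, d x y = d y x) by apply hX.
  eapply Rle_trans; [|apply (iter_lin_couple a ha A hA n
    (fun j j' => K * (d (x j') (x j))^2) h i i' Hi)].
  - rewrite c.
    eapply Rle_trans; [apply Rmult_le_compat_l, iter_bary_jensen; auto|].
    rewrite <- iter_lin_scal by easy. apply (iter_lin_le a ha A hA); intros j _.
    rewrite iter_lin_scal by easy. apply Rmult_le_compat_l; auto. now apply iter_bary_jensen.
  - intros j j' Hj. rewrite c; auto.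
Qed.

(* With [W] the expected sum of the one-step variances along the chain, the one-step inequalities
   telescope to an inequality with [W], and the [n]-step variance is at most [2 ^ n * W]. *)
Lemma iter_bary_variance {X : Type} (d : X -> X -> R) (hX : is_hadamard d) {s : nat}
  (a : idx s -> R) (ha : is_mask a) (n : nat) (x : idx s -> X) (i : idx s) (z : X) :
  (d z (Nat.iter n (bary_scheme d a) x i))^2 + (1 / 2) ^ n *
    Nat.iter n (lin_scheme a) (fun j => (d (x j) (Nat.iter n (bary_scheme d a) x i))^2) i
  <= Nat.iter n (lin_scheme a) (fun j => (d (x j) z)^2) i.
Proof.
  assert (hm : is_metric d) by apply hX.
  assert (c : forall x y, d x y = d y x) by apply hX.
  destruct (mask_radius_exists a ha) as (A & hA).
  assert (H : exists W : idx s -> R,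
    (forall i z, (d z (Nat.iter n (bary_scheme d a) x i))^2 + W i <=
      Nat.iter n (lin_scheme a) (fun j => (d (x j) z)^2) i) /\
    forall i, Nat.iter n (lin_scheme a)
      (fun j => (d (x j) (Nat.iter n (bary_scheme d a) x i))^2) i <= 2 ^ n * W i).
  { clear i z. induction n as [|n (W & H1 & H2)].
    - exists (fun _ => 0); split; intros; simpl.
      + rewrite c; lra.
      + rewrite (proj2 (proj1 (proj2 hm) (x i) (x i)) eq_refl); lra.
    - set (y := Nat.iter n (bary_scheme d a) x) in *.
      set (V := fun i => lin_scheme a (fun j => (d (y j) (bary_scheme d a y i))^2) i).
      assert (HV : forall i, 0 <= V i)
        by (intros i; apply lin_scheme_nonneg; auto; intros; apply pow2_ge_0).
      change (Nat.iter (S n) (bary_scheme d a) x) with (bary_scheme d a y).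
      (* The chain first moves from [i] to some [j], contributing [V i], and then collects [W j]. *)
      exists (fun i => lin_scheme a W i + V i); split.
      + intros i z.
        change (Nat.iter (S n) (lin_scheme a) ?f)
          with (lin_scheme a (Nat.iter n (lin_scheme a) f)).
        pose proof (bary_scheme_variance d hX a ha y i z). fold (V i) in H.
        assert (lin_scheme a (fun j => (d (y j) z)^2) i <=
          1 * lin_scheme a (Nat.iter n (lin_scheme a) (fun j => (d (x j) z)^2)) i +
          (-1) * lin_scheme a W i + 0); [|lra].
        apply lin_scheme_le_comb; auto. intros j. specialize (H1 j z). rewrite c. lra.
      + intros i. set (b := bary_scheme d a y i).
        change (Nat.iter (S n) (lin_scheme a) ?f)
          with (lin_scheme a (Nat.iter n (lin_scheme a) f)).
        (* Passing through [y j] by [dist_sq_le2] doubles the constant: [2 * 2 ^ n * W] averaged,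
           plus [2 * V], is at most [2 ^ (n + 1)] times the new [W]. *)
        apply Rle_trans with
          (2 * 2 ^ n * lin_scheme a W i + 2 * lin_scheme a (fun j => (d (y j) b)^2) i + 0).
        * apply lin_scheme_le_comb; auto. intros j.
          apply Rle_trans with (2 * Nat.iter n (lin_scheme a) (fun q => (d (x q) (y j))^2) j +
            0 * Nat.iter n (lin_scheme a) (fun q => (d (x q) (y j))^2) j + 2 * (d (y j) b)^2).
          -- apply (iter_lin_le_comb a ha A hA). intros q _.
             pose proof (dist_sq_le2 d hm (x q) (y j) b); lra.
          -- specialize (H2 j); lra.
        * change (lin_scheme a (fun j => (d (y j) b)^2) i) with (V i). specialize (HV i).
          assert (1 <= 2 ^ n) by (apply pow_R1_Rle; lra).
          assert (1 * V i <= 2 ^ n * V i) by (apply Rmult_le_compat_r; lra).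
          rewrite <- tech_pow_Rmult. lra. }
  destruct H as (W & H1 & H2). specialize (H1 i z); specialize (H2 i).
  apply Rmult_le_compat_l with (r := (1 / 2) ^ n) in H2; [|apply pow_le; lra].
  rewrite <- Rmult_assoc, <- Rpow_mult_distr in H2.
  replace (1 / 2 * 2) with 1 in H2 by field. rewrite pow1 in H2. lra.
Qed.

(** Iterating the linear scheme [n] times on [delta q] gives, at [i], the probability that the chain
    moves from [i] to [q] in [n] steps. *)
Definition delta {s : nat} (q j : idx s) : R :=
  if excluded_middle_informative (j = q) then 1 else 0.

Lemma iter_lin_ge_delta {s : nat} (a : idx s -> R) (ha : is_mask a) (n : nat)
  (f : idx s -> R) (q i : idx s) :
  (forall j, 0 <= f j) ->
  f q * Nat.iter n (lin_scheme a) (delta q) i <= Nat.iter n (lin_scheme a) f i.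
Proof.
  intros H. destruct (mask_radius_exists a ha) as (A & hA).
  rewrite <- iter_lin_scal by easy. apply (iter_lin_le a ha A hA). intros j _.
  unfold delta. destruct excluded_middle_informative; [subst; lra|specialize (H j); lra].
Qed.

Definition scrambling {s : nat} (a : idx s -> R) (A : Z) (m : nat) (c : R) : Prop :=
  forall i i', near A i i' -> exists q,
    c <= Nat.iter m (lin_scheme a) (delta q) i /\ c <= Nat.iter m (lin_scheme a) (delta q) i'.

(** Both chains hit the common index [q] with probability at least [c], so the detour from [z] to
    [z'] through [x q] is paid for by the two averages. *)
Lemma scrambling_dist {X : Type} (d : X -> X -> R) (hX : is_hadamard d) {s : nat}
  (a : idx s -> R) (ha : is_mask a) (A : Z) (m : nat) (c : R) (hc : scrambling a A m c)
  (x : idx s -> X) (i i' : idx s) (z z' : X) :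
  0 <= c -> near A i i' ->
  c * (d z z')^2 <= 2 * (Nat.iter m (lin_scheme a) (fun j => (d (x j) z)^2) i +
    Nat.iter m (lin_scheme a) (fun j => (d (x j) z')^2) i').
Proof.
  intros Hc Hi. destruct (hc i i' Hi) as (q & H1 & H2).
  assert (hm : is_metric d) by apply hX.
  pose proof (dist_sq_le2 d hm z (x q) z') as H.
  rewrite (proj1 (proj2 (proj2 hm)) z (x q)) in H.
  pose proof (iter_lin_ge_delta a ha m (fun j => (d (x j) z)^2) q i) as E1.
  pose proof (iter_lin_ge_delta a ha m (fun j => (d (x j) z')^2) q i') as E2.
  cbv beta in E1, E2.
  pose proof (pow2_ge_0 (d (x q) z)); pose proof (pow2_ge_0 (d (x q) z')).
  specialize (E1 (fun j => pow2_ge_0 _)); specialize (E2 (fun j => pow2_ge_0 _)).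
  nra.
Qed.

Lemma reach_exists {s : nat} (A : Z) (n : nat) (i : idx s) :
  (1 <= A)%Z -> exists q, reach A n i q.
Proof.
  intros HA. exists (fun k => (i k / 2 ^ Z.of_nat n)%Z). intros k.
  pose proof (Zpow2_pos n). set (p := (2 ^ Z.of_nat n)%Z) in *.
  pose proof (Z.div_mod (i k) p); pose proof (Z.mod_pos_bound (i k) p). nia.
Qed.

(* Every block of [m] steps in which the values at [i] and [i'] do not get close contributes to
   the accumulated variance [G]; since [G] stays bounded, [r] blocks give a factor [1 / r]. *)
Lemma iter_bary_spread {X : Type} (d : X -> X -> R) (hX : is_hadamard d) {s : nat}
  (a : idx s -> R) (ha : is_mask a) (A : Z) (hA : mask_radius a A) (m : nat) (c : R)
  (c0 : 0 <= c) (hc : scrambling a A m c) (r : nat) (x : idx s -> X) :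
  exists G : idx s -> R,
    (forall i z, (d z (Nat.iter (r * m) (bary_scheme d a) x i))^2 + (1 / 2) ^ m * G i <=
      Nat.iter (r * m) (lin_scheme a) (fun j => (d (x j) z)^2) i) /\
    (forall i i', near A i i' ->
      INR r * c * (d (Nat.iter (r * m) (bary_scheme d a) x i)
        (Nat.iter (r * m) (bary_scheme d a) x i'))^2 <= 2 * G i + 2 * G i').
Proof.
  assert (cm : forall x y, d x y = d y x) by apply hX.
  induction r as [|r (G & H1 & H2)].
  - exists (fun _ => 0); split; intros; simpl; [rewrite cm|]; lra.
  - simpl (S r * m)%nat.
    set (v := Nat.iter (r * m) (bary_scheme d a) x) in *.
    set (T := fun i => Nat.iter m (lin_scheme a)
      (fun j => (d (v j) (Nat.iter m (bary_scheme d a) v i))^2) i).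
    (* The loss [(1 / 2) ^ m] is incurred once per block, so the factor in front of [G] does not
       depend on [r]. *)
    exists (fun i => Nat.iter m (lin_scheme a) G i + T i).
    rewrite (Nat.iter_add _ _ _ (bary_scheme d a)). fold v. split.
    + intros i z. rewrite Nat.iter_add.
      pose proof (iter_bary_variance d hX a ha m v i z) as E. fold (T i) in E.
      assert (Nat.iter m (lin_scheme a) (fun j => (d (v j) z)^2) i <=
        1 * Nat.iter m (lin_scheme a)
          (Nat.iter (r * m) (lin_scheme a) (fun j => (d (x j) z)^2)) i +
        (- (1 / 2) ^ m) * Nat.iter m (lin_scheme a) G i + 0); [|lra].
      apply (iter_lin_le_comb a ha A hA). intros j _. rewrite cm. specialize (H1 j z). lra.
    + intros i i' Hi. rewrite S_INR.
      pose proof (scrambling_dist d hX a ha A m c hc v i i'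
        (Nat.iter m (bary_scheme d a) v i) (Nat.iter m (bary_scheme d a) v i') c0 Hi) as E1.
      fold (T i) (T i') in E1.
      (* Coupling carries the bound for the first [r] blocks through the new block, which itself
         adds one more [c] through [E1]. *)
      pose proof (iter_bary_couple d hX a ha A hA m v (INR r * c) (fun j => 2 * G j) i i') as E2.
      rewrite !iter_lin_scal in E2 by easy.
      specialize (E2 (Rmult_le_pos _ _ (pos_INR r) c0) Hi H2). lra.
Qed.

(** Squared distances are bounded to match Jensen's inequality; dividing [D] by [4] thus halves
    distances. *)
Definition near_bound {X : Type} (d : X -> X -> R) {s : nat} (A : Z) (x : idx s -> X) (D : R) :
  Prop := forall i i', near A i i' -> (d (x i) (x i'))^2 <= D.

Lemma iter_bary_near_bound {X : Type} (d : X -> X -> R) (hX : is_hadamard d) {s : nat}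
  (a : idx s -> R) (ha : is_mask a) (A : Z) (hA : mask_radius a A) (n : nat)
  (x : idx s -> X) (D : R) :
  near_bound d A x D -> near_bound d A (Nat.iter n (bary_scheme d a) x) D.
Proof.
  intros H i i' Hi.
  pose proof (iter_bary_couple d hX a ha A hA n x 1 (fun _ => D / 2) i i') as E.
  rewrite !iter_lin_const in E by easy.
  assert (1 * (d (Nat.iter n (bary_scheme d a) x i) (Nat.iter n (bary_scheme d a) x i'))^2
    <= D); [|lra].
  eapply Rle_trans; [apply E; auto; [lra|]|lra].
  intros j j' Hj; specialize (H j j' Hj); lra.
Qed.

Lemma iter_bary_reach_bound {X : Type} (d : X -> X -> R) (hX : is_hadamard d) {s : nat}
  (a : idx s -> R) (ha : is_mask a) (A : Z) (hA : mask_radius a A) (n : nat)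
  (x : idx s -> X) (D : R) (i q i' : idx s) :
  near_bound d A x D -> near A i i' -> reach A n i' q ->
  Nat.iter n (lin_scheme a) (fun j => (d (x j) (x q))^2) i <= D.
Proof.
  intros H Hi Hq.
  replace D with (0 * Nat.iter n (lin_scheme a) (fun _ => 0) i +
    0 * Nat.iter n (lin_scheme a) (fun _ => 0) i + D) by ring.
  apply (iter_lin_le_comb a ha A hA). intros j Hj.
  specialize (H j q (reach_near A n i i' j q Hi Hj Hq)). lra.
Qed.

(** Testing against a value [x q] reachable from [i] gives [th * G <= D] at both indices, hence
    [r * c * th * d2 <= 4 * D]. Choosing [r * c * th > 16] yields [D / 4], with [N] depending on
    neither the space nor the data. *)
Lemma scrambling_contraction {s : nat} (a : idx s -> R) (ha : is_mask a) (A : Z)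
  (hA : mask_radius a A) (m : nat) (c : R) (c0 : 0 < c) (hc : scrambling a A m c) :
  exists N, forall (X : Type) (d : X -> X -> R) (x : idx s -> X) (D : R), is_hadamard d ->
    near_bound d A x D -> near_bound d A (Nat.iter N (bary_scheme d a) x) (D / 4).
Proof.
  set (th := (1 / 2) ^ m).
  assert (Hth : 0 < th) by (apply pow_lt; lra).
  assert (Hct : 0 < c * th) by now apply Rmult_lt_0_compat.
  destruct (INR_unbounded (16 / (c * th))) as (r & Hr).
  apply Rmult_gt_compat_r with (r := c * th) in Hr; [|easy].
  replace (16 / (c * th) * (c * th)) with 16 in Hr by (field; lra).
  exists (r * m)%nat. intros X d x D hX HD i i' Hi.
  destruct (iter_bary_spread d hX a ha A hA m c (Rlt_le _ _ c0) hc r x) as (G & H1 & H2).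
  destruct (reach_exists A (r * m) i (proj1 hA)) as (q & Hq).
  specialize (H2 i i' Hi).
  pose proof (H1 i (x q)) as E; pose proof (H1 i' (x q)) as E'.
  pose proof (iter_bary_reach_bound d hX a ha A hA (r * m) x D i q i HD
    (near_refl A i (proj1 hA)) Hq) as F.
  pose proof (iter_bary_reach_bound d hX a ha A hA (r * m) x D i' q i HD
    (near_sym A i i' Hi) Hq) as F'.
  fold th in E, E'.
  set (d2 := (d (Nat.iter (r * m) (bary_scheme d a) x i)
    (Nat.iter (r * m) (bary_scheme d a) x i'))^2) in *.
  assert (0 <= d2) by apply pow2_ge_0.
  pose proof (pow2_ge_0 (d (x q) (Nat.iter (r * m) (bary_scheme d a) x i))).
  pose proof (pow2_ge_0 (d (x q) (Nat.iter (r * m) (bary_scheme d a) x i'))).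
  assert (th * (INR r * c * d2) <= th * (2 * G i + 2 * G i'))
    by (apply Rmult_le_compat_l; lra).
  assert (16 * d2 <= INR r * (c * th) * d2) by (apply Rmult_le_compat_r; lra).
  lra.
Qed.

(** * Scrambling of convergent linear schemes *)

Lemma box_finite (s : nat) (B : Z) :
  exists L : list (idx s), forall q, (forall k, (Z.abs (q k) <= B)%Z) -> In q L.
Proof.
  induction s as [|s (L & HL)].
  - exists (cons (fun _ => 0%Z) nil). intros q _. left.
    extensionality k. now apply (Fin.case0 (fun k => 0%Z = q k)).
  - set (range := map (fun n => (Z.of_nat n - B)%Z) (seq 0 (Z.to_nat (2 * B + 1)))).
    set (ext := fun (z : Z) (r : idx s) (k : Fin.t (S s)) =>
      Fin.caseS' k (fun _ => Z) z r).
    exists (flat_map (fun z => map (ext z) L) range). intros q Hq.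
    apply in_flat_map. exists (q Fin.F1). split.
    + specialize (Hq Fin.F1). apply in_map_iff. exists (Z.to_nat (q Fin.F1 + B)%Z).
      split; [lia|]. apply in_seq; lia.
    + apply in_map_iff. exists (fun k => q (Fin.FS k)). split; [|auto].
      extensionality k. now apply (Fin.caseS' k (fun k => ext _ _ k = q k)).
Qed.

(** The selection [g] need not be increasing: [g n >= n] is enough to pass to the limit. *)
Lemma bounded_subsequence (u : nat -> R) (B : R) :
  (forall n, Rabs (u n) <= B) ->
  exists (g : nat -> nat) (l : R), (forall n, (g n >= n)%nat) /\ Un_cv (fun n => u (g n)) l.
Proof.
  intros H. destruct (Bolzano_Weierstrass u (fun c => - B <= c <= B)) as (l & Hl).
  { apply compact_P3. }
  { intros n. specialize (H n). unfold Rabs in H; destruct Rcase_abs in H; lra. }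
  assert (E : forall n, exists p, (n <= p)%nat /\ Rabs (u p - l) < (1 / 2) ^ n).
  { intros n. apply (Hl (fun y => Rabs (y - l) < (1 / 2) ^ n)).
    assert (Hp : 0 < (1 / 2) ^ n) by (apply pow_lt; lra).
    exists (mkposreal _ Hp). intros y Hy; exact Hy. }
  exists (fun n => proj1_sig (constructive_indefinite_description _ (E n))), l. split.
  - intros n. exact (proj1 (proj2_sig (constructive_indefinite_description _ (E n)))).
  - intros eps He. destruct (scaled_pow_half_small 1 eps He) as (N & HN).
    exists N; intros n Hn. specialize (HN n Hn). unfold Rdist.
    pose proof (proj2 (proj2_sig (constructive_indefinite_description _ (E n)))). lra.
Qed.

Lemma bounded_subsequence_Rs (s : nat) (u : nat -> Fin.t s -> R) (B : R) :
  (forall n k, Rabs (u n k) <= B) ->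
  exists (g : nat -> nat) (l : Fin.t s -> R), (forall n, (g n >= n)%nat) /\
    forall eps, 0 < eps -> exists N, forall n, (n >= N)%nat ->
      forall k, Rabs (u (g n) k - l k) < eps.
Proof.
  induction s as [|s IH]; intros H.
  - exists (fun n => n), (fun _ => 0). split; [auto|]. intros eps _. exists 0%nat. intros n _ k.
    apply (Fin.case0 (fun k => Rabs (u n k - 0) < eps)).
  - destruct (IH (fun n k => u n (Fin.FS k))) as (g & l & Hg & Hl); [auto|].
    destruct (bounded_subsequence (fun n => u (g n) Fin.F1) B) as (h & l0 & Hh & Hl0); [auto|].
    exists (fun n => g (h n)), (fun k => Fin.caseS' k (fun _ => R) l0 l). split.
    + intros n. specialize (Hh n); specialize (Hg (h n)); lia.
    + intros eps He. destruct (Hl eps He) as (N & HN). destruct (Hl0 eps He) as (N0 & HN0).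
      exists (N + N0)%nat. intros n Hn k.
      apply (Fin.caseS' k (fun k => Rabs (u (g (h n)) k - Fin.caseS' k (fun _ => R) l0 l) < eps)).
      * apply HN0; lia.
      * intros k'. apply (HN (h n)). specialize (Hh n); lia.
Qed.

(** Otherwise there is a bad pair at every scale [(1 / 2) ^ n]; along a subsequence both members
    approach one point [t], contradicting continuity there. *)
Lemma continuous_Rs_uniform {X : Type} (d : X -> X -> R) (hd : is_metric d) {s : nat}
  (f : (Fin.t s -> R) -> X) (hf : continuous_Rs d f) (B eps : R) :
  0 < eps -> exists del, 0 < del /\ forall p q : Fin.t s -> R,
    (forall k, Rabs (p k) <= B) -> (forall k, Rabs (p k - q k) < del) -> d (f p) (f q) < eps.
Proof.
  intros He. apply NNPP; intros H.
  assert (Hn : forall n : nat, exists pq : (Fin.t s -> R) * (Fin.t s -> R),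
    (forall k, Rabs (fst pq k) <= B) /\ (forall k, Rabs (fst pq k - snd pq k) < (1 / 2) ^ n) /\
    eps <= d (f (fst pq)) (f (snd pq))).
  { intros n. apply NNPP; intros H'. apply H. exists ((1 / 2) ^ n). split; [apply pow_lt; lra|].
    intros p q Hp Hpq. apply Rnot_le_lt; intros Hle. apply H'. exists (p, q); auto. }
  set (w := fun n => proj1_sig (constructive_indefinite_description _ (Hn n))).
  assert (Hw : forall n, (forall k, Rabs (fst (w n) k) <= B) /\
    (forall k, Rabs (fst (w n) k - snd (w n) k) < (1 / 2) ^ n) /\
    eps <= d (f (fst (w n))) (f (snd (w n)))).
  { intros n. exact (proj2_sig (constructive_indefinite_description _ (Hn n))). }
  destruct (bounded_subsequence_Rs s (fun n => fst (w n)) B) as (g & t & Hg & Ht); [apply Hw|].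
  destruct (hf t (eps / 2)) as (del & Hdel & Hf); [lra|].
  destruct (Ht (del / 2)) as (N & HN); [lra|].
  destruct (scaled_pow_half_small 1 (del / 2)) as (N' & HN'); [lra|].
  set (n := (N + N')%nat).
  specialize (HN n ltac:(unfold n; lia)).
  specialize (HN' (g n) ltac:(specialize (Hg n); unfold n in *; lia)).
  destruct (Hw (g n)) as (_ & H1 & H2).
  destruct hd as (_ & _ & c & tri).
  assert (E1 : d (f t) (f (fst (w (g n)))) < eps / 2).
  { apply Hf. intros k. specialize (HN k). simpl in HN. lra. }
  assert (E2 : d (f t) (f (snd (w (g n)))) < eps / 2).
  { apply Hf. intros k. specialize (HN k); specialize (H1 k). simpl in HN.
    unfold Rabs in *. repeat destruct Rcase_abs; lra. }
  specialize (tri (f (fst (w (g n)))) (f t) (f (snd (w (g n))))).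
  rewrite (c (f (fst (w (g n)))) (f t)) in tri. lra.
Qed.

Lemma sum_list_ge_term {A : Type} (f : A -> R) (L : list A) (x : A) :
  (forall y, 0 <= f y) -> In x L -> f x <= sum_list f L.
Proof.
  intros H. assert (H0 : forall L, 0 <= sum_list f L).
  { intros M; induction M as [|y M IH]; simpl; [lra|]. specialize (H y); lra. }
  induction L as [|y L IH]; simpl; [easy|]. intros [->|Hx].
  - specialize (H0 L); lra.
  - specialize (IH Hx); specialize (H y); lra.
Qed.

Lemma iter_lin_sum_list {s : nat} (a : idx s -> R) (ha : is_mask a) (n : nat) {B : Type}
  (f : B -> idx s -> R) (L : list B) (i : idx s) :
  Nat.iter n (lin_scheme a) (fun j => sum_list (fun b => f b j) L) i =
  sum_list (fun b => Nat.iter n (lin_scheme a) (f b) i) L.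
Proof.
  induction L as [|b L IH]; simpl sum_list.
  - now apply iter_lin_const.
  - rewrite <- IH.
    pose proof (iter_lin_comb a ha n 1 1 0 (f b) (fun j => sum_list (fun b => f b j) L) i) as E.
    replace (fun j => f b j + sum_list (fun b => f b j) L)
      with (fun j => 1 * f b j + 1 * sum_list (fun b => f b j) L + 0)
      by (extensionality j; ring).
    rewrite E; ring.
Qed.

Lemma delta_pos_reach {s : nat} (a : idx s -> R) (ha : is_mask a) (A : Z)
  (hA : mask_radius a A) (n : nat) (q i : idx s) :
  0 < Nat.iter n (lin_scheme a) (delta q) i -> reach A n i q.
Proof.
  intros H. apply NNPP; intros Hr.
  assert (Nat.iter n (lin_scheme a) (delta q) i <= Nat.iter n (lin_scheme a) (fun _ => 0) i).
  { apply (iter_lin_le a ha A hA). intros j Hj. unfold delta.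
    destruct excluded_middle_informative; [subst; contradiction|lra]. }
  rewrite iter_lin_const in H0 by easy. lra.
Qed.

(** All indices reachable from [i] lie within [2 * A] of one of them, so the total weight one is
    shared by at most [K] indices, with [K] independent of [n] and [i]. *)
Lemma delta_large_exists {s : nat} (a : idx s -> R) (ha : is_mask a) (A : Z)
  (hA : mask_radius a A) :
  exists c, 0 < c /\ forall n i, exists q, c < Nat.iter n (lin_scheme a) (delta q) i.
Proof.
  destruct (box_finite s (2 * A)) as (L & HL).
  set (K := INR (length L)).
  assert (HK : 0 < K).
  { apply lt_0_INR. specialize (HL (fun _ => 0%Z) ltac:(destruct hA; intros; lia)).
    destruct L; [easy|simpl; lia]. }
  exists (/ (2 * K)). split; [apply Rinv_0_lt_compat; lra|]. intros n i. apply NNPP; intros H.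
  destruct (reach_exists A n i (proj1 hA)) as (q0 & Hq0).
  assert (E : Nat.iter n (lin_scheme a) (fun _ => 1) i <=
    Nat.iter n (lin_scheme a) (fun j => sum_list (fun r => delta (shift (-1) q0 r) j) L) i).
  { apply (iter_lin_le a ha A hA). intros j Hj.
    pose proof (reach_near A n i i j q0 (near_refl A i (proj1 hA)) Hj Hq0) as Hn.
    eapply Rle_trans;
      [|apply (sum_list_ge_term (fun r => delta (shift (-1) q0 r) j) L (shift 1 q0 j))].
    - unfold delta. destruct excluded_middle_informative as [_|F]; [lra|].
      exfalso; apply F. extensionality k; unfold shift; lia.
    - intros r. unfold delta. destruct excluded_middle_informative; lra.
    - apply HL. intros k; specialize (Hn k); unfold shift; lia. }
  rewrite iter_lin_const, iter_lin_sum_list in E by easy.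
  assert (E' : sum_list (fun b => Nat.iter n (lin_scheme a) (delta (shift (-1) q0 b)) i) L <=
    sum_list (fun _ => / (2 * K)) L).
  { apply sum_list_le. intros b. apply Rnot_lt_le; intros F; apply H; eauto. }
  rewrite sum_list_const in E'. fold K in E'.
  replace (K * / (2 * K)) with (/ 2) in E' by (field; lra).
  pose proof (Rle_trans _ _ _ E E'); lra.
Qed.

(** An index [q] likely from [i] is also likely from [i'], because both probabilities are close to
    values of one uniformly continuous limit at close points. *)
Lemma convergent_scrambling {s : nat} (a : idx s -> R) (ha : is_mask a) (A : Z)
  (hA : mask_radius a A) :
  convergent Rabs_dist (lin_scheme a) -> exists m c, 0 < c /\ scrambling a A m c.
Proof.
  intros hc. set (zero := (fun _ => 0%Z) : idx s).
  destruct (hc (delta zero)) as (phi & Hphi & Hlim).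
  { exists 0, 1. intros j. unfold Rabs_dist, delta.
    destruct excluded_middle_informative; unfold Rabs; destruct Rcase_abs; lra. }
  destruct (delta_large_exists a ha A hA) as (c & Hc & Hq).
  (* The box of radius [A] contains the rescaled point of [i - 2 ^ m * q] whenever [q] is reachable
     from [i]. The total loss is below [c / 8 + c / 8 + c / 4], leaving [c / 2]. *)
  destruct (continuous_Rs_uniform Rabs_dist (proj1 Rabs_dist_hadamard) phi Hphi (IZR A) (c / 4))
    as (del & Hdel & Hu); [lra|].
  destruct (Hlim (c / 8)) as (N & HN); [lra|].
  destruct (scaled_pow_half_small (2 * IZR A) del Hdel) as (N' & HN').
  set (m := (N + N')%nat). specialize (HN m ltac:(unfold m; lia)).
  specialize (HN' m ltac:(unfold m; lia)).
  exists m, (c / 2). split; [lra|]. intros i i' Hi.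
  destruct (Hq m i) as (q & Hqi). exists q.
  pose proof (delta_pos_reach a ha A hA m q i ltac:(lra)) as Hr.
  (* Translation reduces every [q] to the origin, so the single limit [phi] serves all of them. *)
  assert (E : forall i, Nat.iter m (lin_scheme a) (delta q) i =
    Nat.iter m (lin_scheme a) (delta zero) (shift (2 ^ Z.of_nat m) q i)).
  { intros j. rewrite iter_lin_shift by easy. f_equal. extensionality r.
    unfold delta, zero. destruct excluded_middle_informative as [F|F],
      excluded_middle_informative as [F'|F']; auto; exfalso.
    - apply F'; subst; extensionality k; unfold shift; lia.
    - apply F; extensionality k.
      apply (f_equal (fun g => g k)) in F'; unfold shift in F'; lia. }
  pose proof (pow_lt 2 m Rlt_0_2) as Hp2.
  assert (Hh : (1 / 2) ^ m = / 2 ^ m) by (unfold Rdiv; now rewrite Rmult_1_l, pow_inv).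
  rewrite !E in *.
  pose proof (HN (shift (2 ^ Z.of_nat m) q i)) as H1.
  pose proof (HN (shift (2 ^ Z.of_nat m) q i')) as H2.
  assert (H3 : Rabs_dist (phi (dyadic m (shift (2 ^ Z.of_nat m) q i)))
    (phi (dyadic m (shift (2 ^ Z.of_nat m) q i'))) < c / 4).
  { apply Hu; intros k; unfold dyadic, shift.
    - specialize (Hr k). pose proof (Zpow2_pos m).
      unfold Rdiv; rewrite Rabs_mult, (Rabs_pos_eq (/ 2 ^ m))
        by (left; now apply Rinv_0_lt_compat).
      rewrite <- abs_IZR. apply Rmult_le_reg_r with (2 ^ m); [easy|].
      rewrite Rmult_assoc, Rinv_l, Rmult_1_r, <- IZR_pow2, <- mult_IZR by lra.
      apply IZR_le. destruct hA. nia.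
    - specialize (Hi k). rewrite <- Rdiv_minus_distr, <- minus_IZR.
      unfold Rdiv; rewrite Rabs_mult, (Rabs_pos_eq (/ 2 ^ m))
        by (left; now apply Rinv_0_lt_compat).
      rewrite <- abs_IZR, <- Hh. eapply Rle_lt_trans; [|exact HN'].
      apply Rmult_le_compat_r; [rewrite Hh; left; now apply Rinv_0_lt_compat|].
      rewrite <- mult_IZR. apply IZR_le. lia. }
  unfold Rabs_dist in *. unfold Rabs in *. repeat destruct Rcase_abs; split; lra.
Qed.

(** * Convergence in Hadamard spaces *)

(** Blocks of [N] steps shrink the initial bound geometrically (the factor [1 / 4] is relaxed to
    [1 / 2]), and the remaining steps cannot increase it. *)
Lemma contraction_vanishing {X : Type} (d : X -> X -> R) (hX : is_hadamard d) {s : nat}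
  (a : idx s -> R) (ha : is_mask a) (A : Z) (hA : mask_radius a A) (N : nat)
  (hN : forall (x : idx s -> X) D, near_bound d A x D ->
    near_bound d A (Nat.iter N (bary_scheme d a) x) (D / 4))
  (x : idx s -> X) (hx : Defs.bounded d x) (eps : R) :
  0 < eps -> exists n0, forall n, (n >= n0)%nat ->
    near_bound d A (Nat.iter n (bary_scheme d a) x) eps.
Proof.
  intros He. destruct hx as (z & M & HM).
  pose proof hX as ((p & _ & c & t) & _).
  assert (H0 : near_bound d A x ((2 * M)^2)).
  { intros i i' _. apply pow_incr. split; [auto|].
    pose proof (HM i); pose proof (HM i'). specialize (t (x i) z (x i')).
    rewrite (c (x i) z) in t. lra. }
  assert (Hk : forall k,
    near_bound d A (Nat.iter (k * N) (bary_scheme d a) x) ((2 * M)^2 * (1 / 2) ^ k)).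
  { induction k as [|k IH].
    - simpl ((1 / 2) ^ 0). rewrite Rmult_1_r. exact H0.
    - simpl (S k * N)%nat. rewrite Nat.iter_add. intros i i' Hi.
      specialize (hN _ _ IH i i' Hi). simpl ((1 / 2) ^ S k).
      assert (0 <= (2 * M)^2 * (1 / 2) ^ k)
        by (apply Rmult_le_pos; [apply pow2_ge_0|apply pow_le; lra]).
      lra. }
  destruct (scaled_pow_half_small ((2 * M)^2) eps He) as (k & HK).
  specialize (HK k (le_n k)). exists (k * N)%nat. intros n Hn.
  replace n with ((n - k * N) + k * N)%nat by lia. rewrite Nat.iter_add.
  apply iter_bary_near_bound; auto. intros i i' Hi. specialize (Hk k i i' Hi). lra.
Qed.

(** Index of the half-open dyadic cube of side [2 ^ (- n)] containing [p], named by its lower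
    corner. *)
Definition cell {s : nat} (n : nat) (p : Fin.t s -> R) : idx s := fun k => Int_part (2 ^ n * p k).

Lemma cell_spec {s : nat} (n : nat) (p : Fin.t s -> R) (k : Fin.t s) :
  IZR (cell n p k) <= 2 ^ n * p k < IZR (cell n p k) + 1.
Proof. destruct (base_Int_part (2 ^ n * p k)). unfold cell. lra. Qed.

Lemma cell_dyadic {s : nat} (n : nat) (j : idx s) : cell n (dyadic n j) = j.
Proof.
  extensionality k. pose proof (pow_lt 2 n Rlt_0_2). symmetry. apply Int_part_spec.
  unfold dyadic. replace (2 ^ n * (IZR (j k) / 2 ^ n)) with (IZR (j k)) by (field; lra). lra.
Qed.

Lemma cell_reach {s : nat} (A : Z) (n t : nat) (p : Fin.t s -> R) :
  (1 <= A)%Z -> reach A t (cell (t + n) p) (cell n p).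
Proof.
  intros HA k. pose proof (cell_spec n p k) as H1. pose proof (cell_spec (t + n) p k) as H2.
  rewrite pow_add in H2. pose proof (pow_lt 2 t Rlt_0_2) as H3. pose proof (Zpow2_pos t) as H4.
  rewrite <- (IZR_pow2 t) in H2, H3. rewrite Rmult_assoc in H2.
  set (P := (2 ^ Z.of_nat t)%Z) in *. set (v := 2 ^ n * p k) in *.
  set (i := cell (t + n) p k) in *. set (q := cell n p k) in *.
  assert (F1 : IZR (P * q) < IZR (i + 1)) by (rewrite mult_IZR, plus_IZR; nra).
  assert (F2 : IZR i < IZR (P * (q + 1))) by (rewrite mult_IZR, plus_IZR; nra).
  apply lt_IZR in F1, F2.
  assert ((P - 1) * 1 <= (P - 1) * A)%Z by (apply Z.mul_le_mono_nonneg_l; lia). lia.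
Qed.

(** After scaling, the coordinates differ by less than [1], so their floors differ by at most [1],
    which is within [2 * A]. *)
Lemma cell_near {s : nat} (A : Z) (n : nat) (p q : Fin.t s -> R) :
  (1 <= A)%Z -> (forall k, Rabs (q k - p k) < (1 / 2) ^ n) -> near A (cell n p) (cell n q).
Proof.
  intros HA H k. specialize (H k).
  pose proof (cell_spec n p k) as H1. pose proof (cell_spec n q k) as H2.
  pose proof (pow_lt 2 n Rlt_0_2) as H3.
  apply Rmult_lt_compat_l with (r := 2 ^ n) in H; [|easy].
  rewrite <- Rpow_mult_distr in H. replace (2 * (1 / 2)) with 1 in H by field. rewrite pow1 in H.
  assert (H4 : Rabs (2 ^ n * q k - 2 ^ n * p k) < 1).
  { rewrite <- Rmult_minus_distr_l, Rabs_mult, (Rabs_pos_eq (2 ^ n)); lra. }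
  apply Rabs_def2 in H4.
  assert (F1 : IZR (cell n p k) < IZR (cell n q k + 2)) by (rewrite plus_IZR; lra).
  assert (F2 : IZR (cell n q k) < IZR (cell n p k + 2)) by (rewrite plus_IZR; lra).
  apply lt_IZR in F1, F2. lia.
Qed.

(** The limit at [r] is that of the values on the dyadic cells containing [r]. The Cauchy estimate
    is uniform in [r], which gives both continuity and uniform convergence. *)
Lemma vanishing_convergent {X : Type} (d : X -> X -> R) (hX : is_hadamard d) {s : nat}
  (a : idx s -> R) (ha : is_mask a) (A : Z) (hA : mask_radius a A) (x : idx s -> X) :
  (forall eps, 0 < eps -> exists n0, forall n, (n >= n0)%nat ->
    near_bound d A (Nat.iter n (bary_scheme d a) x) eps) ->
  exists f : (Fin.t s -> R) -> X, continuous_Rs d f /\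
    forall eps, eps > 0 -> exists N, forall n, (n >= N)%nat ->
      forall j, d (f (dyadic n j)) (Nat.iter n (bary_scheme d a) x j) <= eps.
Proof.
  intros H. set (y := fun n => Nat.iter n (bary_scheme d a) x).
  pose proof hX as ((p & e & c & t) & hc & _).
  (* By Jensen's inequality a value at level [n] stays close to all values it descends from, so
     no rate of decay is needed for the Cauchy property. *)
  assert (H1 : forall eps, 0 < eps -> exists n0,
    (forall i i', near A i i' -> d (y n0 i) (y n0 i') <= eps) /\
    forall n, (n >= n0)%nat -> forall r, d (y n (cell n r)) (y n0 (cell n0 r)) <= eps).
  { intros eps He. destruct (H (eps ^ 2)) as (n0 & Hn0); [now apply pow_lt|].
    specialize (Hn0 n0 (le_n n0)). fold (y n0) in Hn0.
    assert (Hsq : forall u v, (d u v)^2 <= eps ^ 2 -> d u v <= eps).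
    { intros u v Huv. apply Rsqr_incr_0_var; [rewrite !Rsqr_pow2; easy|lra]. }
    exists n0. split; [intros; apply Hsq; auto|]. intros n Hn r. apply Hsq.
    replace n with ((n - n0) + n0)%nat by lia. set (m := (n - n0)%nat). unfold y at 1.
    rewrite Nat.iter_add. fold (y n0). rewrite c.
    eapply Rle_trans; [apply iter_bary_jensen; auto|].
    eapply (iter_bary_reach_bound d hX a ha A hA m (y n0)); eauto.
    - apply near_refl, hA.
    - apply cell_reach, hA. }
  assert (H2 : forall r, exists l, forall eps, eps > 0 -> exists N, forall n, (n >= N)%nat ->
    d (y n (cell n r)) l < eps).
  { intros r. apply hc. intros eps He. destruct (H1 (eps / 3)) as (n0 & _ & Hn0); [lra|].
    exists n0. intros m n Hm Hn. pose proof (Hn0 m Hm r); pose proof (Hn0 n Hn r).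
    specialize (t (y m (cell m r)) (y n0 (cell n0 r)) (y n (cell n r))).
    rewrite (c (y n0 (cell n0 r))) in t. lra. }
  set (f := fun r => proj1_sig (constructive_indefinite_description _ (H2 r))).
  assert (Hf : forall r eps, eps > 0 -> exists N, forall n, (n >= N)%nat ->
    d (y n (cell n r)) (f r) < eps)
    by (intros r; exact (proj2_sig (constructive_indefinite_description _ (H2 r)))).
  assert (H3 : forall eps, 0 < eps -> exists n0,
    (forall i i', near A i i' -> d (y n0 i) (y n0 i') <= eps) /\
    forall n, (n >= n0)%nat -> forall r, d (f r) (y n (cell n r)) <= eps).
  { intros eps He. destruct (H1 (eps / 4)) as (n0 & Hn & Hn0); [lra|]. exists n0. split.
    - intros i i' Hi; specialize (Hn i i' Hi); lra.
    - intros n Hge r. destruct (Hf r (eps / 4)) as (N & HN); [lra|].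
      specialize (HN (N + n0)%nat ltac:(lia)).
      pose proof (Hn0 (N + n0)%nat ltac:(lia) r) as E1. pose proof (Hn0 n Hge r) as E2.
      set (w := y (N + n0)%nat (cell (N + n0) r)) in *.
      set (w0 := y n0 (cell n0 r)) in *. set (wn := y n (cell n r)) in *.
      pose proof (t (f r) w wn). pose proof (t w w0 wn).
      rewrite (c (f r) w) in *. rewrite (c w0 wn) in *. lra. }
  exists f. split.
  (* The path from [f r] to [f q] passes through the level-[n0] values on the two cells, at three
     times [eps / 4]. *)
  - intros r eps He. destruct (H3 (eps / 4)) as (n0 & Hn & Hn0); [lra|].
    exists ((1 / 2) ^ n0). split; [apply pow_lt; lra|]. intros q Hq.
    pose proof (Hn _ _ (cell_near A n0 r q (proj1 hA) Hq)) as E.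
    pose proof (Hn0 n0 (le_n n0) r) as E1. pose proof (Hn0 n0 (le_n n0) q) as E2.
    pose proof (t (f r) (y n0 (cell n0 r)) (f q)).
    pose proof (t (y n0 (cell n0 r)) (y n0 (cell n0 q)) (f q)).
    rewrite (c (f q)) in E2. lra.
  - intros eps He. destruct (H3 eps He) as (n0 & _ & Hn0). exists n0. intros n Hn j.
    specialize (Hn0 n Hn (dyadic n j)). now rewrite cell_dyadic in Hn0.
Qed.

(** * The equivalence *)

Lemma lin_convergent_bary_convergent {s : nat} (a : idx s -> R) (ha : is_mask a) :
  convergent Rabs_dist (lin_scheme a) ->
  forall (X : Type) (d : X -> X -> R), is_hadamard d -> convergent d (bary_scheme d a).
Proof.
  intros hc X d hX x hx.
  destruct (mask_radius_exists a ha) as (A & hA).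
  destruct (convergent_scrambling a ha A hA hc) as (m & c & Hc & Hs).
  destruct (scrambling_contraction a ha A hA m c Hc Hs) as (N & HN).
  apply (vanishing_convergent d hX a ha A hA).
  intros eps He. apply (contraction_vanishing d hX a ha A hA N); auto.
Qed.

Theorem theorem1 (s : nat) (a : idx s -> R) (ha : is_mask a) :
  ((forall (X : Type) (d : X -> X -> R), is_hadamard d -> convergent d (bary_scheme d a))
     <-> convergent Rabs_dist (bary_scheme Rabs_dist a)) /\
  ((forall (X : Type) (d : X -> X -> R), is_hadamard d -> convergent d (bary_scheme d a))
     <-> convergent Rabs_dist (lin_scheme a)).
Proof.
  (* Identifying the two schemes on the reals makes both equivalences the same statement. *)
  rewrite (bary_scheme_Rabs_dist a ha).
  assert (H : (forall (X : Type) (d : X -> X -> R), is_hadamard d ->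
    convergent d (bary_scheme d a)) <-> convergent Rabs_dist (lin_scheme a)).
  { split; [|now apply lin_convergent_bary_convergent].
    intros H. rewrite <- (bary_scheme_Rabs_dist a ha). apply H, Rabs_dist_hadamard. }
  split; exact H.
Qed.
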